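(* The affine Schur algebra $S_\vartriangle(2,2)$ over $\mathbb{Q}$ (at $q=1$) has finite global dimension.
   Context: **The affine Schur algebra $S_\vartriangle(2,2)$ over $\mathbb{Q}$.** Let $I(\mathbb{Z},2)=\mathbb{Z}\times\mathbb{Z}$, with elements $\underline{i}=(i_1,i_2)$. Let $\mathfrak{S}_\vartriangle=\mathfrak{S}_2\ltimes\mathbb{Z}^2$ be the extended affine Weyl group, acting on $I(\mathbb{Z},2)$ from the right, with $\mathfrak{S}_2$ acting by place permutation and $\varepsilon\in\mathbb{Z}^2$ acting by $\underline{i}\mapsto\underline{i}+2\varepsilon$. It acts diagonally on $I(\mathbb{Z},2)\times I(\mathbb{Z},2)$; write $(\underline{i},\underline{j})\sim(\underline{k},\underline{l})$ if the two pairs lie in the same orbit. $S_\vartriangle(2,2)$ is the $\mathbb{Q}$-algebra with basis the symbols $\xi_{\underline{i},\underline{j}}$ ($\underline{i},\underline{j}\in I(\mathbb{Z},2)$), where $\xi_{\underline{i},\underline{j}}$ and $\xi_{\underline{k},\underline{l}}$ are identified if and only if $(\underline{i},\underline{j})\sim(\underline{k},\underline{l})$, and multiplication $$\xi_{\underline{i},\underline{j}}\,\xi_{\underline{k},\underline{l}}=\sum_{(\underline{p},\underline{q})}C(\underline{i},\underline{j},\underline{k},\underline{l},\underline{p},\underline{q})\,\xi_{\underline{p},\underline{q}},\qquad C(\underline{i},\underline{j},\underline{k},\underline{l},\underline{p},\underline{q})=\bigl|\{\underline{s}\in I(\mathbb{Z},2): (\underline{i},\underline{j})\sim(\underline{p},\underline{s}),\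 (\underline{s},\underline{q})\sim(\underline{k},\underline{l})\}\bigr|,$$ the sum being over representatives $(\underline{p},\underline{q})$ of the $\mathfrak{S}_\vartriangle$-orbits on $I(\mathbb{Z},2)\times I(\mathbb{Z},2)$. The unit is $\xi_{(1,1),(1,1)}+\xi_{(1,2),(1,2)}+\xi_{(2,2),(2,2)}$. *)

(* Defs.v *)
From HB Require Import structures.
From mathcomp Require Import all_boot all_order all_algebra.
From mathcomp Require Import generic_quotient finmap.
From mathcomp Require Import mathcomp_extra boolp classical_sets functions.
From mathcomp Require Import cardinality fsbigop.
From mathcomp Require Import monalg.
From mathcomp Require Import zify.

Set Implicit Arguments.
Unset Strict Implicit.
Unset Printing Implicit Defensive.

Import GRing.Theory.
Local Open Scope quotient_scope.
Local Open Scope classical_set_scope.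
Local Open Scope ring_scope.

Definition projective (R : pzRingType) (P : lmodType R) : Prop :=
  forall (M N : lmodType R) (g : {linear M -> N}) (f : {linear P -> N}),
    (forall y, exists x, g x = y) ->
    exists h : {linear P -> M}, forall x, g (h x) = f x.

(* M has a projective resolution                                              *)
(*   0 -> P n -> ... -> P 1 -> P 0 -> M -> 0                                  *)
(* written as an infinite exact sequence with P k = 0 for k > n.              *)
Definition proj_dim_le (R : pzRingType) (M : lmodType R) (n : nat) : Prop :=
  exists (P : nat -> lmodType R) (d : forall k, {linear P k.+1 -> P k})
    (e : {linear P 0%N -> M}),
  [/\ forall k, projective (P k),
      forall k, (n < k)%N -> forall x : P k, x = 0,
      forall y, exists x, e x = y,
      forall x, e x = 0 <-> exists x', d 0%N x' = x
    & forall k x, d k x = 0 <-> exists x', d k.+1 x' = x].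

(* Left modules: the sides agree for the algebra below, since                 *)
(* xi i j |-> xi j i is an anti-automorphism of it.                           *)
Definition finite_global_dimension (R : pzRingType) : Prop :=
  exists n : nat, forall M : lmodType R, proj_dim_le M n.

Notation idx := (int * int)%type.

(* The pair (w, e), w in S_2 (true being the transposition) and e in Z^2,     *)
(* ranges over the extended affine Weyl group; it acts by the place           *)
(* permutation w followed by the translation by 2e.                           *)
Definition act (w : bool) (e i : idx) : idx :=
  (if w then (i.2, i.1) else i) + e *+ 2.

Definition orbit_rel (x y : idx * idx) : Prop :=
  exists w e, y = (act w e x.1, act w e x.2).

Definition orbit_relb (x y : idx * idx) : bool := `[< orbit_rel x y >].

Lemma actE w e i : act w e i = act w 0 i + e *+ 2.
Proof. by rewrite /act mul0rn addr0. Qed.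

Lemma act_id i : act false 0 i = i.
Proof. by rewrite /act mul0rn addr0. Qed.

Lemma act_comp w e w' e' i :
  act w' e' (act w e i) = act (w' (+) w) (e' + act w' 0 e) i.
Proof.
rewrite /act; case: i e e' => [i1 i2] [a b] [c d].
by case: w; case: w' => /=; congr pair => /=; lia.
Qed.

Lemma actK w e : cancel (act w e) (act w (- act w 0 e)).
Proof.
by move=> i; rewrite act_comp addbb addNr act_id.
Qed.

Lemma act_inj w e : injective (act w e).
Proof. exact: can_inj (actK w e). Qed.

Lemma orbit_rel_refl x : orbit_rel x x.
Proof. by exists false, 0; rewrite !act_id; case: x. Qed.

Lemma orbit_rel_sym x y : orbit_rel x y -> orbit_rel y x.
Proof. by move=> [w [e ->]]; exists w, (- act w 0 e); rewrite /= !actK; case: x. Qed.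

Lemma orbit_rel_trans y x z : orbit_rel x y -> orbit_rel y z -> orbit_rel x z.
Proof.
move=> [w [e ->]] [w' [e' ->]] /=.
by exists (w' (+) w), (e' + act w' 0 e); rewrite !act_comp.
Qed.

Lemma orbit_relb_equiv : equiv_class_of orbit_relb.
Proof.
split=> [x|x y|y x z].
- exact/asboolP/orbit_rel_refl.
- by apply/asboolP/asboolP; apply: orbit_rel_sym.
- by move=> /asboolP xy /asboolP yz; apply/asboolP/(orbit_rel_trans xy yz).
Qed.

Canonical orbit_equiv := EquivRelPack orbit_relb_equiv.

Definition orbit := {eq_quot orbit_equiv}.
HB.instance Definition _ := Choice.on orbit.

Definition orb (i j : idx) : orbit := \pi_({eq_quot orbit_equiv}) (i, j).
Definition row_rep (c : orbit) : idx := (repr c).1.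
Definition col_rep (c : orbit) : idx := (repr c).2.

Definition structure_set (i j k l p q : idx) : set idx :=
  [set s | orbit_rel (i, j) (p, s) /\ orbit_rel (s, q) (k, l)].

(* structure_set is always finite (finite_structure_set below), so this is    *)
(* its genuine cardinality.                                                   *)
Definition structure_const (i j k l p q : idx) : nat :=
  #|` fset_set (structure_set i j k l p q)|%fset.

(* S(2,2) is the free Q-module on the orbits, as finitely supported families  *)
(* of coefficients; << c >> is the basis element of the orbit c, x@_c the     *)
(* coefficient of x on it.                                                    *)
Definition affine_schur22 : Type := {malg rat[orbit]}.
HB.instance Definition _ := GRing.Lmodule.on affine_schur22.

(* Locked, as unification otherwise unfolds the quotient.                     *)
HB.lock Definition xi (i j : idx) : affine_schur22 := << orb i j >>.

(* The sum over c has finitely many nonzero terms (schur_mul_supp below).     *)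
Definition schur_mul (x y : affine_schur22) : affine_schur22 :=
  \sum_(a <- msupp x) \sum_(b <- msupp y) (x@_a * y@_b) *:
    (\sum_(c \in [set: orbit])
       (structure_const (row_rep a) (col_rep a) (row_rep b) (col_rep b)
          (row_rep c) (col_rep c))%:R *: xi (row_rep c) (col_rep c)).

Definition schur_one : affine_schur22 :=
  xi (1, 1) (1, 1) + xi (1, 2) (1, 2) + xi (2, 2) (2, 2).

Lemma orbP i j k l : reflect (orbit_rel (i, j) (k, l)) (orb i j == orb k l).
Proof.
apply: (iffP eqP) => [/eqmodP/asboolP //|h].
exact/eqmodP/asboolP.
Qed.

Lemma orb_rep c : orb (row_rep c) (col_rep c) = c.
Proof. by rewrite /orb -surjective_pairing reprK. Qed.

Lemma orb_act w e i j : orb (act w e i) (act w e j) = orb i j.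
Proof. by apply/esym/eqP/orbP; exists w, e. Qed.

Lemma mcoeff_xi i j c : (xi i j)@_c = (orb i j == c)%:R.
Proof. rewrite unlock; exact: mcoeffU. Qed.

Lemma xi_eq i j k l : xi i j = xi k l <-> orbit_rel (i, j) (k, l).
Proof.
split=> [h|/orbP/eqP h]; last by rewrite unlock h.
apply/orbP; have := mcoeff_xi k l (orb k l).
rewrite -[xi k l]h (mcoeff_xi i j) eqxx.
by case: (orb i j == orb k l) => // /esym/eqP; rewrite oner_eq0.
Qed.

(* The s with (i, j) ~ (p, s).                                                *)
Definition second_cand (i j p : idx) : seq idx :=
  [seq act w 0 j + (p - act w 0 i) | w <- [:: true; false]].

Lemma second_candP i j p s : orbit_rel (i, j) (p, s) -> s \in second_cand i j p.
Proof.
move=> [w [e [-> ->]]]; apply/mapP; exists w; first by case: w.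
by rewrite (actE w e i) (actE w e j) [act w 0 i + _]addrC addrK.
Qed.

Lemma finite_structure_set i j k l p q :
  finite_set (structure_set i j k l p q).
Proof.
apply: (@sub_finite_set _ _ [set` second_cand i j p]); last exact: finite_seq.
by move=> s [/second_candP].
Qed.

Lemma structure_constE i j k l p q (D : seq idx) : uniq D ->
    (forall s, orbit_rel (i, j) (p, s) -> s \in D) ->
  (structure_const i j k l p q)%:R =
    \sum_(s <- D) (orb p s == orb i j)%:R * (orb s q == orb k l)%:R :> rat.
Proof.
move=> uD hD; set P := fun s => (orb p s == orb i j) && (orb s q == orb k l).
have -> : structure_const i j k l p q = size (filter P D).
  rewrite /structure_const; apply/perm_size/uniq_perm.
  - exact: fset_uniq.
  - exact: filter_uniq.
  move=> s; rewrite mem_filter in_fset_set; last exact: finite_structure_set.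
  apply/idP/idP => [|/andP[/andP[/eqP h1 /eqP h2] _]].
    rewrite inE => -[h1 h2]; rewrite (hD _ h1) andbT /P eq_sym.
    by apply/andP; split; apply/orbP.
  by rewrite inE; split; apply/orbP/eqP.
rewrite size_filter -sum1_count natr_sum big_mkcond /=.
by apply: eq_bigr => s _; rewrite /P; do 2!case: (_ == _); rewrite ?mulr0 ?mul0r ?mulr1.
Qed.

Lemma structure_const_act w e i j k l p q :
  structure_const i j k l (act w e p) (act w e q) = structure_const i j k l p q.
Proof.
have hs : structure_set i j k l (act w e p) (act w e q) =
          act w e @` structure_set i j k l p q.
  apply/seteqP; split=> [s [/orbP/eqP h1 /orbP/eqP h2]|_ [s [/orbP/eqP h1 /orbP/eqP h2] <-]].
    have es : s = act w e (act w (- act w 0 e) s).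
      by rewrite act_comp addbb /act /= -{1}[s]addr0; move: s e {h1 h2} => [a b] [c d]; case: w => /=; congr pair => /=; lia.
    exists (act w (- act w 0 e) s) => //; move: h1 h2; rewrite {1 2}es !orb_act => h1 h2.
    by split; apply/orbP/eqP.
  by split; apply/orbP/eqP; rewrite orb_act.
rewrite /structure_const hs fset_set_image; last exact: finite_structure_set.
by rewrite card_imfset //; apply: act_inj.
Qed.

Lemma structure_const_supp i j k l p q :
    structure_const i j k l p q != 0%N ->
  orb p q \in [seq orb i t | t <- second_cand k l j].
Proof.
rewrite /structure_const.
have [->|/set0P [s]] := eqVneq (structure_set i j k l p q) set0.
  by rewrite fset_set0.
move=> [/orbit_rel_sym [w [e [-> ->]]] /orbit_rel_sym sq] _.
rewrite -(orb_act w e p q); apply: map_f.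
by apply: second_candP (orbit_rel_trans sq _); exists w, e.
Qed.

Lemma schur_mul_supp i j k l :
  finite_set [set c | structure_const i j k l (row_rep c) (col_rep c) != 0%N].
Proof.
apply: (@sub_finite_set _ _ [set` [seq orb i t | t <- second_cand k l j]]);
  last exact: finite_seq.
by move=> c /= /structure_const_supp; rewrite orb_rep.
Qed.

Lemma mcoeff_structure_sum i j k l p q :
  (\sum_(c \in [set: orbit])
     (structure_const i j k l (row_rep c) (col_rep c))%:R *:
       xi (row_rep c) (col_rep c))@_(orb p q)
  = (structure_const i j k l p q)%:R.
Proof.
pose A := (orb p q |` [fset orb i t | t in second_cand k l j])%fset.
rewrite (fsbigTE A); last first.
  move=> c; rewrite !inE negb_or => /andP[_ cA].
  have [->|] := eqVneq (structure_const i j k l (row_rep c) (col_rep c)) 0%N.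
    by rewrite scale0r.
  move=> /structure_const_supp; rewrite orb_rep => /mapP[t tk ec].
  by case/negP: cA; apply/imfsetP; exists t.
rewrite raddf_sum (big_fsetD1 (orb p q)) /=; last by rewrite fset1U1.
rewrite big_seq big1 ?addr0 => [|c]; last first.
  rewrite !inE => /andP[/negPf cpq _].
  by rewrite mcoeffZ mcoeff_xi orb_rep cpq mulr0.
rewrite mcoeffZ mcoeff_xi orb_rep eqxx mulr1.
have /orbP[w [e [-> ->]]] : orb p q == orb (row_rep (orb p q)) (col_rep (orb p q)).
  by rewrite orb_rep.
by rewrite structure_const_act.
Qed.

Lemma mcoeff_schur_mul (x y : affine_schur22) p q (D : seq idx) : uniq D ->
    (forall s, x@_(orb p s) != 0 -> s \in D) ->
  (schur_mul x y)@_(orb p q) = \sum_(s <- D) x@_(orb p s) * y@_(orb s q).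
Proof.
move=> uD hD; rewrite /schur_mul raddf_sum /=.
pose F a b s : rat := x@_a * y@_b * ((orb p s == a)%:R * (orb s q == b)%:R).
transitivity (\sum_(a <- msupp x) \sum_(b <- msupp y) \sum_(s <- D) F a b s).
  rewrite big_seq [RHS]big_seq; apply: eq_bigr => a ax.
  rewrite raddf_sum /=; apply: eq_bigr => b _.
  rewrite mcoeffZ mcoeff_structure_sum (@structure_constE _ _ _ _ _ _ D) //.
    by rewrite !orb_rep mulr_sumr.
  move=> s /orbP/eqP; rewrite orb_rep => eas.
  by apply: hD; rewrite -eas mcoeff_neq0.
have coefE (z : affine_schur22) (c : orbit) :
    z@_c = \sum_(a <- msupp z) z@_a * (c == a)%:R.
  rewrite {1}(monalgE z) raddf_sum /=; apply: eq_bigr => a _.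
  by rewrite mcoeffU eq_sym mulr_natr.
transitivity (\sum_(s <- D) \sum_(a <- msupp x) \sum_(b <- msupp y) F a b s).
  by rewrite [RHS]exchange_big; apply: eq_bigr => a _; rewrite [RHS]exchange_big.
apply: eq_bigr => s _.
rewrite [x@_(orb p s)]coefE mulr_suml; apply: eq_bigr => a _.
rewrite [y@_(orb s q)]coefE mulr_sumr; apply: eq_bigr => b _.
by rewrite /F mulrACA.
Qed.

Definition row_supp (x : affine_schur22) (p : idx) : seq idx :=
  undup (flatten [seq second_cand (row_rep a) (col_rep a) p | a <- msupp x]).

Lemma row_suppP (x : affine_schur22) p s :
  x@_(orb p s) != 0 -> s \in row_supp x p.
Proof.
rewrite mcoeff_neq0 mem_undup => xs; apply/flatten_mapP; exists (orb p s) => //.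
by apply/second_candP/orbP; rewrite orb_rep.
Qed.

Lemma schur_ext (x y : affine_schur22) :
  (forall p q, x@_(orb p q) = y@_(orb p q)) -> x = y.
Proof. by move=> h; apply/malgP => c; rewrite -(orb_rep c). Qed.

Lemma schur_mulA : associative schur_mul.
Proof.
move=> x y z; apply: schur_ext => p q.
pose D := undup (row_supp (schur_mul x y) p ++
                 flatten [seq row_supp y s | s <- row_supp x p]).
rewrite (@mcoeff_schur_mul x _ _ _ (row_supp x p)) ?undup_uniq //; last first.
  exact: row_suppP.
rewrite (@mcoeff_schur_mul _ z _ _ D) ?undup_uniq //; last first.
  by move=> s /row_suppP h; rewrite mem_undup mem_cat h.
transitivity (\sum_(s <- row_supp x p) \sum_(t <- D)
    x@_(orb p s) * y@_(orb s t) * z@_(orb t q)).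
  rewrite big_seq [RHS]big_seq; apply: eq_bigr => s sx.
  rewrite (@mcoeff_schur_mul y z _ _ D) ?undup_uniq //; last first.
    move=> t /row_suppP h; rewrite mem_undup mem_cat; apply/orP; right.
    by apply/flatten_mapP; exists s.
  by rewrite mulr_sumr; apply: eq_bigr => t _; rewrite mulrA.
rewrite exchange_big; apply: eq_bigr => t _ /=.
rewrite (@mcoeff_schur_mul x y _ _ (row_supp x p)) ?undup_uniq //; last first.
  exact: row_suppP.
by rewrite mulr_suml.
Qed.

Lemma orb_diag u p s : (orb u u == orb p s) = (p == s) && (orb u u == orb p p).
Proof.
apply/idP/andP => [/orbP [w [e [-> ->]]]|[/eqP <-] //].
by rewrite !eqxx orb_act.
Qed.

Lemma orb_diag_parity (u p : idx) : (orb u u == orb p p) =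
  (((p.1 - u.1) %% 2)%Z == 0) && (((p.2 - u.2) %% 2)%Z == 0) ||
  (((p.1 - u.2) %% 2)%Z == 0) && (((p.2 - u.1) %% 2)%Z == 0).
Proof.
case: u p => [u1 u2] [p1 p2] /=; apply/orbP/orP => [[w [e []]]|].
  case: e => e1 e2; rewrite /act; case: w => /= -> -> _ _.
    right; lia.
  left; lia.
case=> h; [exists false, (((p1 - u1) %/ 2)%Z, ((p2 - u2) %/ 2)%Z)
          |exists true, (((p1 - u2) %/ 2)%Z, ((p2 - u1) %/ 2)%Z)];
  rewrite /act /=; congr pair; congr pair => /=; lia.
Qed.

Lemma mcoeff_schur_one p s : schur_one@_(orb p s) = (p == s)%:R.
Proof.
rewrite /schur_one 2!mcoeffD 3!mcoeff_xi 3!(orb_diag _ p s).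
case: eqP => _ /=; last by rewrite !addr0.
rewrite -!natrD !orb_diag_parity; congr (_ *+ _) => /=; case: p => a b /=; lia.
Qed.

Lemma schur_mul1x : left_id schur_one schur_mul.
Proof.
move=> x; apply: schur_ext => p q; rewrite (@mcoeff_schur_mul _ _ _ _ [:: p]) //.
  by rewrite big_seq1 mcoeff_schur_one eqxx mul1r.
move=> s; rewrite mcoeff_schur_one inE [s == p]eq_sym.
by case: (p == s); rewrite // mulr0n eqxx.
Qed.

Lemma schur_mulx1 : right_id schur_one schur_mul.
Proof.
move=> x; apply: schur_ext => p q.
rewrite (@mcoeff_schur_mul _ _ _ _ (undup (q :: row_supp x p))) ?undup_uniq //.
  rewrite (bigD1_seq q) ?undup_uniq ?mem_undup ?mem_head //=.
  rewrite mcoeff_schur_one eqxx mulr1 big1 ?addr0 // => s /negPf sq.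
  by rewrite mcoeff_schur_one sq mulr0.
by move=> s /row_suppP h; rewrite mem_undup inE h orbT.
Qed.

Lemma schur_mulDl : left_distributive schur_mul +%R.
Proof.
move=> x y z; apply: schur_ext => p q.
pose D := undup (row_supp (x + y) p ++ row_supp x p ++ row_supp y p).
rewrite mcoeffD !(@mcoeff_schur_mul _ _ _ _ D) ?undup_uniq //.
- by rewrite -big_split; apply: eq_bigr => s _; rewrite mcoeffD mulrDl.
- by move=> s /row_suppP h; rewrite mem_undup !mem_cat h !orbT.
- by move=> s /row_suppP h; rewrite mem_undup !mem_cat h !orbT.
- by move=> s /row_suppP h; rewrite mem_undup !mem_cat h.
Qed.

Lemma schur_mulDr : right_distributive schur_mul +%R.
Proof.
move=> x y z; apply: schur_ext => p q.
rewrite mcoeffD !(@mcoeff_schur_mul x _ _ _ (row_supp x p)) ?undup_uniq //;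
  try exact: row_suppP.
by rewrite -big_split; apply: eq_bigr => s _; rewrite mcoeffD mulrDr.
Qed.

Lemma schur_one_neq0 : schur_one != 0.
Proof.
apply/eqP => /(congr1 (mcoeff (orb 0 0))); rewrite mcoeff_schur_one mcoeff0 eqxx.
by move/eqP; rewrite oner_eq0.
Qed.

HB.instance Definition _ := GRing.Zmodule_isNzRing.Build affine_schur22
  schur_mulA schur_mul1x schur_mulx1 schur_mulDl schur_mulDr schur_one_neq0.

Lemma schur_scaleAl (c : rat) (x y : affine_schur22) :
  c *: (x * y) = (c *: x) * y.
Proof.
apply: schur_ext => p q.
pose D := undup (row_supp (c *: x) p ++ row_supp x p).
rewrite mcoeffZ !(@mcoeff_schur_mul _ _ _ _ D) ?undup_uniq //.
- by rewrite mulr_sumr; apply: eq_bigr => s _; rewrite mcoeffZ mulrA.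
- by move=> s /row_suppP h; rewrite mem_undup !mem_cat h.
- by move=> s /row_suppP h; rewrite mem_undup !mem_cat h orbT.
Qed.

HB.instance Definition _ :=
  GRing.Lmodule_isLalgebra.Build rat affine_schur22 schur_scaleAl.

Lemma schur_scaleAr (c : rat) (x y : affine_schur22) :
  c *: (x * y) = x * (c *: y).
Proof.
apply: schur_ext => p q.
rewrite mcoeffZ !(@mcoeff_schur_mul x _ _ _ (row_supp x p)) ?undup_uniq //;
  try exact: row_suppP.
by rewrite mulr_sumr; apply: eq_bigr => s _; rewrite mcoeffZ mulrCA.
Qed.

HB.instance Definition _ :=
  GRing.Lalgebra_isAlgebra.Build rat affine_schur22 schur_scaleAr.

Lemma xi_mul i j k l :
  xi i j * xi k l = \sum_(c \in [set: orbit])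
    (structure_const i j k l (row_rep c) (col_rep c))%:R *:
      xi (row_rep c) (col_rep c).
Proof.
apply: schur_ext => p q; rewrite mcoeff_structure_sum.
pose D := undup (row_supp (xi i j) p ++ second_cand i j p).
rewrite (@mcoeff_schur_mul _ _ _ _ D) ?undup_uniq //; last first.
  by move=> s /row_suppP h; rewrite mem_undup mem_cat h.
rewrite (@structure_constE _ _ _ _ _ _ D) ?undup_uniq //; last first.
  by move=> s /second_candP h; rewrite mem_undup mem_cat h orbT.
apply: eq_bigr => s _; rewrite !mcoeff_xi.
by rewrite [orb i j == _]eq_sym [orb k l == _]eq_sym.
Qed.

Lemma schur1E : 1 = xi (1, 1) (1, 1) + xi (1, 2) (1, 2) + xi (2, 2) (2, 2).
Proof. by []. Qed.

(* Main.v *)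
Require Import Defs.
From HB Require Import structures.
From mathcomp Require Import all_boot all_algebra.
From mathcomp Require Import finmap boolp classical_sets.
From mathcomp Require Import monalg zify.

(* At b = (1, 2), which has trivial stabilizer, the corner f S f of the       *)
(* idempotent f = xi b b contains the ring B of Laurent polynomials in two    *)
(* variables, spanned by the xi b (b + 2e), and f S is a free B-module on the *)
(* xi b i, i in {1, 2}^2. As                                                  *)
(*   (1 / 2) * \sum_i xi i b (x) xi b i   in  S f (x)_B f S                   *)
(* is S-central and multiplies to 1, averaging over it turns B-linear         *)
(* liftings into S-linear ones, so an S-module P is projective as soon as f P *)
(* is B-projective. Since B is obtained from the rationals by adjoining two   *)
(* invertible variables, each of which raises the global dimension by one,    *)
(* f K is B-projective for every second syzygy K.                             *)

Set Implicit Arguments.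
Unset Strict Implicit.
Unset Printing Implicit Defensive.

Import GRing.Theory.
Local Open Scope ring_scope.

Local Notation S := affine_schur22.

(** * Projective dimension *)

(** Two facts bound the global dimension by 2. The first is a separability argument: [base] has
    trivial stabilizer, and the order 2 of the symmetric group is invertible in the rationals, so
    averaging with the element of [casimir] turns a lifting that commutes with all translations into
    an S-linear one ([averagedZ], [transl_projective_projective]). The second is a syzygy theorem
    for Laurent polynomials. Every [idem] M is projective over the rationals ([transl_projective0],
    through [linear_section]). If a free cover F of P is given and P is projective over the
    translations in D, then the kernel is projective over those in D and one more
    ([ker_transl_projective]); the hypotheses on F hold by [free_transl_projective] and
    [free_transl_acyclic]. Two directions generate all translations, so every second syzygy is
    projective. The Laurent ring is never built: its modules are the corners of S-modules, and its
    linear maps are functions between S-modules that factor through [idem] and commute with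
    translations. *)

Lemma linear_section (K : fieldType) (X Y : lmodType K) (g : {linear X -> Y}) :
  (forall y, exists x, g x = y) -> exists s : {linear Y -> X}, cancel s g.
Proof.
move=> gsurj.
(* On a maximal such W the map [g] is bijective: a missing value would let W grow by the line
   through a preimage. Membership of 0 is not demanded, so that the union of the empty chain
   qualifies; maximality restores it. *)
pose indep (W : set X) := (forall a u v, W u -> W v -> W (a *: u + v)) /\
  (forall u, W u -> g u = 0 -> u = 0).
have [|W [[Wlin Wker] Wmax]] := @Zorn_bigcup X indep.
  move=> C CP Ctot; split=> [a u v [A CA Au] [B CB Bv]|u [A CA Au]].
    have [AB|BA] := Ctot _ _ CA CB.
      by exists B => //; apply: (CP _ CB).1 => //; apply: AB.
    by exists A => //; apply: (CP _ CA).1 => //; apply: BA.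
  exact: (CP _ CA).2.
have W0 : W 0.
  apply: contrapT => nW0; apply: (Wmax [set x | W x \/ x = 0]%classic).
    split=> [x|sub]; first by left.
    by apply: nW0; apply: sub; right.
  split=> [a u v [Wu|->] [Wv|->]|u [/Wker //|//]].
  - by left; apply: Wlin.
  - rewrite addr0; have := Wlin (a - 1) _ _ Wu Wu.
    by rewrite scalerBl scale1r subrK; left.
  - by left; rewrite scaler0 add0r.
  - by right; rewrite scaler0 add0r.
have gW y : exists w, W w /\ g w = y.
  apply: contrapT => ny; have [x gx] := gsurj y.
  apply: (Wmax [set v | exists w c, W w /\ v = c *: x + w]%classic).
    split=> [w Ww|sub]; first by exists w, 0; rewrite scale0r add0r.
    apply: ny; exists x; split=> //; apply: sub.
    by exists 0, 1; rewrite scale1r addr0.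
  split=> [a _ _ [w [c [Ww ->]]] [w' [c' [Ww' ->]]]|_ [w [c [Ww ->]]]].
    exists (a *: w + w'), (a * c + c'); split; first exact: Wlin.
    by rewrite scalerDr scalerA scalerDl addrACA.
  have [->|c0] := eqVneq c 0; first by rewrite scale0r add0r; exact: Wker.
  rewrite linearD linearZ /= gx => /eqP; rewrite addr_eq0 => /eqP cy; case: ny.
  exists (- c^-1 *: w + 0); split; first exact: Wlin.
  by rewrite addr0 linearZ /= scaleNr -scalerN -cy scalerA mulVf // scale1r.
pose s y := projT1 (cid (gW y)).
have sP y : W (s y) /\ g (s y) = y := projT2 (cid (gW y)).
have slin : linear s.
  move=> a u v; apply/eqP; rewrite -subr_eq0; apply/eqP/Wker.
    by rewrite -scaleN1r [X in W X]addrC; apply/Wlin; first apply/Wlin; exact: (sP _).1.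
  by rewrite linearB linearP /= !(sP _).2 subrr.
pose sL := GRing.isLinear.Build K Y X _ s slin.
pose sH : {linear Y -> X} := HB.pack s sL.
by exists sH => y; exact: (sP y).2.
Qed.

Section Kernel.
Variables (R : pzRingType) (U V : lmodType R) (g : {linear U -> V}).

Definition ker_pred : {pred U} := [pred x | g x == 0].

Fact ker_submod : submod_closed ker_pred.
Proof.
split=> [|a x y]; rewrite !inE ?linear0 // linearP => /eqP-> /eqP->.
by rewrite scaler0 addr0.
Qed.

HB.instance Definition _ := GRing.isSubmodClosed.Build R U ker_pred ker_submod.

Record ker := Ker {ker_val : U; _ : ker_val \in ker_pred}.

HB.instance Definition _ := [isSub for ker_val].
HB.instance Definition _ := [Choice of ker by <:].
HB.instance Definition _ := [SubChoice_isSubLmodule of ker by <:].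

Lemma ker_valP (x : ker) : g (val x) = 0.
Proof. exact/eqP/(valP x). Qed.

Lemma ker_lift x : g x = 0 -> exists k : ker, val k = x.
Proof. by move=> /eqP gx; exists (Ker gx). Qed.

End Kernel.

Lemma projective_eq0 (R : pzRingType) (P : lmodType R) :
  (forall x : P, x = 0) -> projective P.
Proof.
move=> P0 M N g f _; exists (\0 : {linear P -> M}) => x.
by rewrite linear0 (P0 x) linear0.
Qed.

Lemma projective_proj_dim_le (R : pzRingType) (P : lmodType R) :
  projective P -> proj_dim_le P 0.
Proof.
move=> projP; pose Q k : lmodType R := if k is 0%N then P else 'rV[R]_0.
have Q0 k (x : Q k.+1) : x = 0 by exact: thinmx0.
exists Q, (fun k => \0 : {linear Q k.+1 -> Q k}), (idfun : {linear P -> P}).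
split=> //.
- by case=> // k; apply/projective_eq0/Q0.
- by case.
- by move=> y; exists y.
- by move=> x; split=> [/= ->|[x' <-]] //; exists 0.
- by move=> k x; split=> // _; exists 0; rewrite (Q0 _ x).
Qed.

(** Dimension shifting: the resolution of the kernel is spliced onto [P] through its
    augmentation. *)
Lemma ker_proj_dim_le (R : pzRingType) (P M : lmodType R) (e : {linear P -> M}) n :
  projective P -> (forall y, exists x, e x = y) ->
  proj_dim_le (ker e) n -> proj_dim_le M n.+1.
Proof.
move=> projP esurj [Q [d [e' [projQ Q0 e'surj e'd dd]]]].
pose Q' k : lmodType R := if k is k'.+1 then Q k' else P.
pose d' k : {linear Q' k.+1 -> Q' k} :=
  if k is k'.+1 then d k' else (val : {linear ker e -> P}) \o e'.
exists Q', d', e; split=> //.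
- by case.
- by case=> // k; rewrite ltnS; apply: Q0.
- move=> x; split=> [/ker_lift[y <-]|[x' <-]]; last exact: ker_valP.
  by have [z <-] := e'surj y; exists z.
case=> [|k] x; last exact: dd.
split=> [x0|]; first exact/e'd/val_inj.
by move/e'd=> x0; rewrite /= x0.
Qed.

(** * The corner of the algebra at a regular index *)

Definition base : idx := (1, 2).
Local Notation idem := (xi base base).

Definition swap (i : idx) : idx := (i.2, i.1).

Lemma mcoeff_mul (x y : S) p q (D : seq idx) : uniq D ->
    (forall s, x@_(orb p s) != 0 -> s \in D) ->
  (x * y : S)@_(orb p q) = \sum_(s <- D) x@_(orb p s) * y@_(orb s q).
Proof. exact: mcoeff_schur_mul. Qed.

Lemma orb_shift e i j : orb (i + e *+ 2) (j + e *+ 2) = orb i j.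
Proof. exact: (orb_act false e i j). Qed.

Lemma orb_swap i j : orb (swap i) (swap j) = orb i j.
Proof. by rewrite -(orb_act true 0 i j) /act mul0rn !addr0. Qed.

(** The entries of [base] differ in parity, so an even translation cannot undo the swap. This is the
    trivial stabilizer on which the corner computations rest. *)
Lemma act_base w e w' e' : act w e base = act w' e' base -> w = w' /\ e = e'.
Proof.
case: e e' => [a b] [c d]; rewrite /act /base; case: w; case: w' => /= -[h1 h2];
  by [split=> //; congr pair; lia | exfalso; lia].
Qed.

Lemma orb_baser i j : (orb i base == orb j base) = (i == j).
Proof.
apply/orbP/eqP => [[w [e h]]|->]; last exact: orbit_rel_refl.
move: (congr1 fst h) (congr1 snd h) => /= -> {}h.
have [<- <-] : false = w /\ 0 = e by apply: act_base; rewrite act_id.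
by rewrite act_id.
Qed.

Lemma orb_basel i j : (orb base i == orb base j) = (i == j).
Proof.
apply/orbP/eqP => [[w [e h]]|->]; last exact: orbit_rel_refl.
move: (congr1 fst h) (congr1 snd h) => /= {}h ->.
have [<- <-] : false = w /\ 0 = e by apply: act_base; rewrite act_id.
by rewrite act_id.
Qed.

Lemma mcoeff_base_mul i (s : S) q : (xi base i * s)@_(orb base q) = s@_(orb i q).
Proof.
rewrite (@mcoeff_mul _ _ _ _ [:: i]) // => [|j].
  by rewrite big_seq1 mcoeff_xi eqxx mul1r.
by rewrite mcoeff_xi orb_basel inE [j == i]eq_sym; case: (i == j); rewrite // mulr0n eqxx.
Qed.

Lemma mcoeff_mul_base j (s : S) p : (s * xi j base)@_(orb p base) = s@_(orb p j).
Proof.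
rewrite (@mcoeff_mul _ _ _ _ (undup (j :: row_supp s p))) ?undup_uniq //.
  rewrite (bigD1_seq j) ?undup_uniq ?mem_undup ?mem_head //=.
  rewrite mcoeff_xi eqxx mulr1 big1 ?addr0 // => i /negPf ij.
  by rewrite mcoeff_xi orb_baser eq_sym ij mulr0.
by move=> i /row_suppP h; rewrite mem_undup inE h orbT.
Qed.

Lemma mcoeff_idem_mul (s : S) p q :
  (xi base base * s)@_(orb p q) = (orb base base == orb p p)%:R * s@_(orb p q).
Proof.
rewrite (@mcoeff_mul _ _ _ _ [:: p]) // => [|i].
  by rewrite big_seq1 mcoeff_xi.
by rewrite mcoeff_xi orb_diag inE [i == p]eq_sym; case: (p == i); rewrite // mulr0n eqxx.
Qed.

Lemma mcoeff_mul_idem (s : S) p q :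
  (s * xi base base)@_(orb p q) = s@_(orb p q) * (orb base base == orb q q)%:R.
Proof.
rewrite (@mcoeff_mul _ _ _ _ (undup (q :: row_supp s p))) ?undup_uniq //.
  rewrite (bigD1_seq q) ?undup_uniq ?mem_undup ?mem_head //=.
  rewrite mcoeff_xi big1 ?addr0 // => i /negPf ij.
  by rewrite mcoeff_xi orb_diag ij mulr0.
by move=> i /row_suppP h; rewrite mem_undup inE h orbT.
Qed.

Lemma idem_mul_xi i : xi base base * xi base i = xi base i.
Proof.
apply: schur_ext => p q; rewrite mcoeff_idem_mul mcoeff_xi.
have [/eqP/orbP [w [e [/= -> _]]]|_] := eqVneq (orb base i) _; last by rewrite mulr0.
by rewrite orb_act eqxx mulr1.
Qed.

Lemma mul_xi_idem i : xi i base * xi base base = xi i base.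
Proof.
apply: schur_ext => p q; rewrite mcoeff_mul_idem mcoeff_xi.
have [/eqP/orbP [w [e [/= _ ->]]]|_] := eqVneq (orb i base) _; last by rewrite mul0r.
by rewrite orb_act eqxx mulr1.
Qed.

(** Left multiplication by [idem] keeps only the rows in the orbit of [base], and the group moves
    each of these to the row of [base] itself. *)
Lemma row_ext (x y : S) : xi base base * x = x -> xi base base * y = y ->
  (forall q, x@_(orb base q) = y@_(orb base q)) -> x = y.
Proof.
move=> fx fy xy; apply: schur_ext => p q; rewrite -fx -fy !mcoeff_idem_mul.
have [/eqP/orbP [w [e [-> _]]]|_] := eqVneq (orb base base) _; last by rewrite !mul0r.
by rewrite -(orb_act w (- act w 0 e) _ q) actK xy.
Qed.

Lemma col_ext (x y : S) : x * xi base base = x -> y * xi base base = y ->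
  (forall p, x@_(orb p base) = y@_(orb p base)) -> x = y.
Proof.
move=> fx fy xy; apply: schur_ext => p q; rewrite -fx -fy !mcoeff_mul_idem.
have [/eqP/orbP [w [e [-> _]]]|_] := eqVneq (orb base base) _; last by rewrite !mulr0.
by rewrite -(orb_act w (- act w 0 e) p _) actK xy.
Qed.

(* These span the Laurent polynomial ring B. *)
Definition transl (e : idx) : S := xi base (base + e *+ 2).

Lemma transl0 : transl 0 = xi base base.
Proof. by rewrite /transl mul0rn addr0. Qed.

Lemma translE e : transl e = xi (base - e *+ 2) base.
Proof. by rewrite /transl unlock -(orb_shift e (_ - _)) subrK. Qed.

Lemma transl_mul_xi e i : transl e * xi base i = xi base (i + e *+ 2).
Proof.
apply: row_ext => [||q]; rewrite ?idem_mul_xi // ?mulrA ?idem_mul_xi //.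
have shift : orb (base + e *+ 2) q = orb base (q - e *+ 2).
  by rewrite -(orb_shift e base) subrK.
rewrite mcoeff_base_mul !mcoeff_xi shift !orb_basel.
by rewrite [i == _]eq_sym subr_eq [q == _]eq_sym.
Qed.

Lemma xi_mul_transl e i : xi i base * transl e = xi (i - e *+ 2) base.
Proof.
rewrite translE; apply: col_ext => [||p]; rewrite -?mulrA ?mul_xi_idem //.
rewrite mcoeff_mul_base !mcoeff_xi -(orb_shift e p) subrK !orb_baser.
by rewrite subr_eq.
Qed.

Lemma translM e e' : transl e * transl e' = transl (e + e').
Proof. by rewrite {2}/transl transl_mul_xi /transl mulrnDl -addrA [e' *+ 2 + _]addrC. Qed.

Lemma row_expand (s : S) i (D : seq idx) : uniq D ->
    (forall q, s@_(orb i q) != 0 -> q \in D) ->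
  xi base i * s = \sum_(q <- D) s@_(orb i q) *: xi base q.
Proof.
move=> uD sD; apply: row_ext => [||q].
- by rewrite mulrA idem_mul_xi.
- by rewrite mulr_sumr; apply: eq_bigr => q _; rewrite -scalerAr idem_mul_xi.
rewrite mcoeff_base_mul raddf_sum /=.
under eq_bigr do rewrite mcoeffZ mcoeff_xi orb_basel.
have [qD|qD] := boolP (q \in D).
  rewrite (bigD1_seq q) //= eqxx mulr1 big1 ?addr0 // => j /negPf ->.
  by rewrite mulr0.
rewrite big_seq big1 => [|j jD].
  exact: contraNeq (sD q) qD.
by case: eqP jD => [->|_ _]; rewrite ?(negPf qD) ?mulr0.
Qed.

Lemma col_expand (s : S) j (D : seq idx) : uniq D ->
    (forall p, s@_(orb p j) != 0 -> p \in D) ->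
  s * xi j base = \sum_(p <- D) s@_(orb p j) *: xi p base.
Proof.
move=> uD sD; apply: col_ext => [||p].
- by rewrite -mulrA mul_xi_idem.
- by rewrite mulr_suml; apply: eq_bigr => p _; rewrite -scalerAl mul_xi_idem.
rewrite mcoeff_mul_base raddf_sum /=.
under eq_bigr do rewrite mcoeffZ mcoeff_xi orb_baser.
have [pD|pD] := boolP (p \in D).
  rewrite (bigD1_seq p) //= eqxx mulr1 big1 ?addr0 // => i /negPf ->.
  by rewrite mulr0.
rewrite big_seq big1 => [|i iD].
  exact: contraNeq (sD p) pD.
by case: eqP iD => [->|_ _]; rewrite ?(negPf pD) ?mulr0.
Qed.

Definition reps : seq idx := [:: (1, 1); (1, 2); (2, 1); (2, 2)].

Lemma repsP (q : idx) : exists j e, j \in reps /\ q = j + e *+ 2.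
Proof.
case: q => a b.
exists (((a - 1) %% 2)%Z + 1, ((b - 1) %% 2)%Z + 1), (((a - 1) %/ 2)%Z, ((b - 1) %/ 2)%Z).
split; last by congr pair => /=; lia.
rewrite !inE /= !xpair_eqE; lia.
Qed.

Lemma reps_inj (i j e e' : idx) : i \in reps -> j \in reps ->
  i + e *+ 2 = j + e' *+ 2 -> i = j /\ e = e'.
Proof.
case: i j e e' => [a b] [c d] [m n] [m' n'].
rewrite !inE /= !xpair_eqE => h1 h2 [h3 h4].
by split; congr pair; lia.
Qed.

Lemma swap_reps i : i \in reps -> swap i \in reps.
Proof. by rewrite !inE => /or4P[] /eqP->. Qed.

Lemma casimir : \sum_(i <- reps) xi i base * xi base i = 2%:R :> S.
Proof.
apply: schur_ext => p q; rewrite raddf_sum raddfMn /= -[1]/schur_one mcoeff_schur_one.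
have [j [e [jr ->]]] := repsP p.
rewrite -(subrK (e *+ 2) q) (inj_eq (addIr _)); move: (q - e *+ 2) => {}q.
(* One term for each element of the symmetric group: between representatives the translation part
   must vanish, so only [base] and [swap base] occur as middle index. Each term sums to the
   coefficient of 1. *)
transitivity (\sum_(i <- reps) ((i == j) * (i == q) +
    (i == swap j) * (i == swap q))%:R : rat).
  rewrite big_seq [RHS]big_seq; apply: eq_bigr => i ir.
  rewrite orb_shift (@mcoeff_mul _ _ _ _ [:: base; swap base]) //.
    rewrite 2!big_cons big_nil addr0 !mcoeff_xi.
    rewrite -(orb_swap j (swap base)) -(orb_swap (swap base)) !orb_baser !orb_basel.
    by rewrite natrD !natrM.
  move=> k; rewrite mcoeff_xi; case: orbP; last by rewrite eqxx.
  case=> w [e' /= [h ->]] _; move: h ir jr.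
  rewrite /act /swap; case: i j e' => [a b] [c d] [m n].
  rewrite !inE /= !xpair_eqE; case: w => /= -[-> ->]; lia.
rewrite -natr_sum big_split /=.
have sumD k l : k \in reps -> (\sum_(i <- reps) (i == k) * (i == l))%N = (k == l).
  move=> kr; rewrite (bigD1_seq k) //= eqxx mul1n big1 ?addn0 // => i /negPf->.
  by rewrite mul0n.
rewrite !sumD ?swap_reps //.
have -> : (swap j == swap q) = (j == q).
  by rewrite /swap !xpair_eqE andbC -xpair_eqE -!surjective_pairing.
by rewrite natrD mulr2n.
Qed.

(** * Maps linear over the translations *)

(** The discrete antiderivative of [w] on the integers that vanishes at 0; [Negz k] stands for -(k +
    1). *)
Definition antidiff (V : zmodType) (w : int -> V) (n : int) : V :=
  match n with
  | Posz k => \sum_(j < k) w j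
  | Negz k => - \sum_(j < k.+1) w (Negz j)
  end.

Lemma antidiffS (V : zmodType) (w : int -> V) n :
  antidiff w (n + 1) = antidiff w n + w n.
Proof.
case: n => [k|[|k]] /=; first by rewrite addn1 big_ord_recr.
  by rewrite big_ord0 big_ord1 addNr.
by rewrite subn1 [in RHS]big_ord_recr /= opprD subrK.
Qed.

Lemma eq_antidiff (V : zmodType) (w w' : int -> V) : w =1 w' -> antidiff w =1 antidiff w'.
Proof. by move=> ww' [k|k] /=; [|congr (- _)]; apply: eq_bigr => j _. Qed.

Lemma antidiff_scale (M : lmodType S) (s : S) (w : int -> M) n :
  s *: antidiff w n = antidiff (fun j => s *: w j) n.
Proof. by case: n => k /=; rewrite ?scalerN scaler_sumr. Qed.

(* h restricts to a rational linear map from idem M to idem N, and factors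
   through the projections to these. *)
Definition corner_linear (M N : lmodType S) (h : M -> N) : Prop :=
  [/\ forall (c : rat) u v, h (c%:A *: u + v) = c%:A *: h u + h v,
      forall z, h (idem *: z) = h z
    & forall z, idem *: h z = h z].

Definition commutes (M N : lmodType S) (h : M -> N) (s : S) : Prop :=
  forall z, h (s *: z) = s *: h z.

Definition transl_linear (D : seq idx) (M N : lmodType S) (h : M -> N) : Prop :=
  corner_linear h /\ {in D, forall e, commutes h (transl e)}.

Lemma scaler_alg (M : lmodType S) (s : S) c (u : M) : s *: (c%:A *: u) = c%:A *: (s *: u).
Proof. by rewrite !scalerA mulr_algl mulr_algr. Qed.

Lemma scale_alg (M : lmodType S) (s : S) (c : rat) (u : M) : (c *: s) *: u = c%:A *: (s *: u).
Proof. by rewrite scalerA mulr_algl. Qed.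

Lemma idem_transl e : idem * transl e = transl e.
Proof. exact: idem_mul_xi. Qed.

Lemma transl_idem e : transl e * idem = transl e.
Proof. by rewrite -transl0 translM addr0. Qed.

Section CornerLinear.
Variables (M N : lmodType S).
Implicit Types h : M -> N.

Lemma corner_linearD h u v : corner_linear h -> h (u + v) = h u + h v.
Proof. by case=> lin _ _; have := lin 1 u v; rewrite !scale1r. Qed.

Lemma corner_linear0 h : corner_linear h -> h 0 = 0.
Proof. by move=> hl; apply: (addrI (h 0)); rewrite -corner_linearD // !addr0. Qed.

Lemma corner_linearZ h c u : corner_linear h -> h (c%:A *: u) = c%:A *: h u.
Proof.
by move=> hl; case: (hl) => lin _ _; have := lin c u 0; rewrite corner_linear0 // !addr0.
Qed.

Lemma corner_linear_sum h I (r : seq I) (F : I -> M) : corner_linear h ->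
  h (\sum_(i <- r) F i) = \sum_(i <- r) h (F i).
Proof.
by move=> hl; apply: (big_morph h) => [u v|]; [exact: corner_linearD|exact: corner_linear0].
Qed.

Lemma corner_linear_expand h I (r : seq I) (a : I -> rat) (s : I -> S) (x : M) :
  corner_linear h ->
  h ((\sum_(i <- r) a i *: s i) *: x) = \sum_(i <- r) (a i)%:A *: h (s i *: x).
Proof.
move=> hl; rewrite scaler_suml corner_linear_sum //; apply: eq_bigr => i _.
by rewrite scale_alg corner_linearZ.
Qed.

Lemma corner_linear_add h h' : corner_linear h -> corner_linear h' ->
  corner_linear (fun z => h z + h' z).
Proof.
move=> [h1 h2 h3] [h1' h2' h3']; split=> [c u v|z|z].
- by rewrite h1 h1' (scalerDr c%:A) addrACA.
- by rewrite h2 h2'.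
- by rewrite (scalerDr idem) h3 h3'.
Qed.

Lemma corner_linear_sub h h' : corner_linear h -> corner_linear h' ->
  corner_linear (fun z => h z - h' z).
Proof.
move=> [h1 h2 h3] [h1' h2' h3']; split=> [c u v|z|z].
- by rewrite h1 h1' opprD (scalerBr c%:A) addrACA.
- by rewrite h2 h2'.
- by rewrite (scalerBr idem) h3 h3'.
Qed.

Lemma corner_linear_pre h e : corner_linear h ->
  corner_linear (fun z => h (transl e *: z)).
Proof.
move=> [h1 h2 h3]; split=> // [c u v|z].
- by rewrite (scalerDr (transl e)) scaler_alg h1.
- by rewrite scalerA transl_idem.
Qed.

Lemma corner_linear_post h e : corner_linear h ->
  corner_linear (fun z => transl e *: h z).
Proof.
move=> [h1 h2 h3]; split=> // [c u v|z|z].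
- by rewrite h1 (scalerDr (transl e)) scaler_alg.
- by rewrite h2.
- by rewrite scalerA idem_transl.
Qed.

Lemma transl_linear_sub D h h' : transl_linear D h -> transl_linear D h' ->
  transl_linear D (fun z => h z - h' z).
Proof.
move=> [hl hD] [hl' hD']; split=> [|e eD z]; first exact: corner_linear_sub.
by rewrite hD // hD' // scalerBr.
Qed.

Lemma commutes0 h : corner_linear h -> commutes h (transl 0).
Proof. by move=> [_ h2 h3] z; rewrite transl0 h2 h3. Qed.

Lemma commutesD h e e' : commutes h (transl e) -> commutes h (transl e') ->
  commutes h (transl (e + e')).
Proof. by move=> he he' z; rewrite -translM -!scalerA he he'. Qed.

(** [transl (- e)] inverts [transl e] up to [idem], which [h] absorbs. Hence a list D of generators
    suffices to express linearity over Laurent polynomials. *)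
Lemma commutesN h e : corner_linear h -> commutes h (transl e) ->
  commutes h (transl (- e)).
Proof.
move=> hl he z; have h0 := commutes0 hl.
rewrite -[in LHS](add0r (- e)) -translM -scalerA h0.
rewrite -(addNr e) -translM -scalerA -he scalerA translM subrr h0.
by rewrite scalerA translM addr0.
Qed.

Lemma commutesMz h e n : corner_linear h -> commutes h (transl e) ->
  commutes h (transl (e *~ n)).
Proof.
move=> hl he; case: n => k.
  elim: k => [|k IH]; first exact: commutes0.
  by rewrite -pmulrn mulrS; apply: commutesD.
rewrite NegzE mulrNz; apply: commutesN => //.
by elim: k => [//|k IH]; rewrite -pmulrn mulrS; apply: commutesD.
Qed.

End CornerLinear.

Lemma corner_linear_comp (M N X : lmodType S) (h : M -> N)
    (g : {linear N -> X}) :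
  corner_linear h -> corner_linear (g \o h).
Proof.
move=> [h1 h2 h3]; split=> [c u v|z|z] /=; first by rewrite h1 linearP.
- by rewrite h2.
- by rewrite -linearZ h3.
Qed.

Lemma transl_linear_comp D (M N X : lmodType S) (h : M -> N)
    (g : {linear N -> X}) :
  transl_linear D h -> transl_linear D (g \o h).
Proof.
move=> [hl hD]; split=> [|e eD z] /=; first exact: corner_linear_comp.
by rewrite hD // linearZ.
Qed.

Lemma transl_linear_precomp D (M N X : lmodType S) (h : M -> N)
    (g : {linear X -> M}) :
  transl_linear D h -> transl_linear D (h \o g).
Proof.
move=> [[h1 h2 h3] hD]; split=> [|e eD z] /=; last by rewrite linearZ hD.
by split=> [c u v|z|z] //=; [rewrite linearP h1|rewrite linearZ h2].
Qed.

Lemma transl_linear_idem D (M N : lmodType S) (f : {linear M -> N}) :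
  transl_linear D (fun z => idem *: f z).
Proof.
split=> [|e _ z].
  split=> [c u v|z|z].
  - by rewrite linearP (scalerDr idem) scaler_alg.
  - by rewrite linearZ /= scalerA idem_mul_xi.
  - by rewrite scalerA idem_mul_xi.
by rewrite linearZ /= !scalerA idem_transl transl_idem.
Qed.

(** * Adjoining an invertible translation *)

(** Projectivity of [idem] P over the Laurent ring on D, tested only against S-linear surjections;
    this is all that the averaging argument consumes. *)
Definition transl_projective (D : seq idx) (P : lmodType S) : Prop :=
  forall (X Y : lmodType S) (g : {linear X -> Y}) (phi : P -> Y),
    (forall y, exists x, g x = y) -> transl_linear D phi ->
    exists psi : P -> X, transl_linear D psi /\ forall z, g (psi z) = phi z.

(* Ext^1(F, X) over the ring generated by the translations in D and e is the
   cokernel of alpha |-> alpha t - t alpha on D-linear maps, t = transl e, when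
   F is projective over D. *)
Definition transl_acyclic (D : seq idx) (e : idx) (F : lmodType S) : Prop :=
  forall (X : lmodType S) (chi : F -> X), transl_linear D chi ->
    exists alpha : F -> X, transl_linear D alpha /\
      forall z, alpha (transl e *: z) = transl e *: alpha z + chi z.

Lemma ker_transl_projective D e (F P : lmodType S) (p : {linear F -> P}) :
    (forall y, exists x, p x = y) -> transl_projective D P ->
    transl_projective (e :: D) F -> transl_acyclic D e F ->
  transl_projective (e :: D) (ker p).
Proof.
(* phi defines a class in Ext^1(P, Y), represented by phi \o delta, where the
   cocycle delta measures how far a section s of p is from commuting with
   transl e. Lifting this representative to X and trivializing it on F gives
   alpha, which lifts phi up to a map that extends to F. *)
move=> psurj projP projF acF X Y g phi gsurj [philin phiD].
have phiD' : transl_linear D phi by split=> // e' De'; apply: phiD; rewrite inE De' orbT.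
have comm e' (N : lmodType S) (z : N) :
    transl e *: (transl e' *: z) = transl e' *: (transl e *: z).
  by rewrite !scalerA !translM addrC.
(* A section of [p] on the corner: it lifts multiplication by [idem], since the identity need not
   factor through [idem]. *)
have [s [[slin sD] ps]] := projP _ _ p _ psurj
  (transl_linear_idem D (idfun : {linear P -> P})).
case: (slin) => s1 s2 s3.
pose delta0 y := transl e *: s y - s (transl e *: y).
have [delta deltaE] : {delta : P -> ker p & forall y, val (delta y) = delta0 y}.
  apply: (@choice _ _ (fun y (k : ker p) => val k = delta0 y)) => y.
  apply: ker_lift; rewrite linearB linearZ /= !ps /=.
  by rewrite !scalerA transl_idem idem_transl subrr.
have deltalin : transl_linear D delta.
  have [[d1 d2 d3] dD] : transl_linear D delta0.
    split; first exact/corner_linear_sub/corner_linear_pre/slin/corner_linear_post.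
    move=> e' De' z; rewrite /delta0 (comm e' _ z) !(sD e' De') (comm e' _ (s z)).
    by rewrite -scalerBr.
  split; first split=> [c u v|z|z].
  - by apply: val_inj; rewrite linearP /= !deltaE d1.
  - by apply: val_inj; rewrite !deltaE d2.
  - by apply: val_inj; rewrite linearZ /= !deltaE d3.
  - by move=> e' De' z; apply: val_inj; rewrite linearZ /= !deltaE dD.
have [[k1 k2 k3] kD] := deltalin.
have [|chi [chilin gchi]] := projP _ _ g (phi \o delta) gsurj.
  case: (philin) => f1 f2 f3; split; first split=> [c u v|z|z] /=.
  - by rewrite k1 f1.
  - by rewrite k2.
  - by rewrite f3.
  - by move=> e' De' z /=; rewrite kD // phiD'.2.
have [alpha [alphalin alphae]] := acF _ _ (transl_linear_precomp p chilin).
(* The projection of the corner of [F] onto that of the kernel along [s]; its failure to commute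
   with [transl e] is exactly [delta]. *)
have [q qE] : {q : F -> ker p & forall z, val (q z) = idem *: z - s (p z)}.
  apply: (@choice _ _ (fun z (k : ker p) => val k = idem *: z - s (p z))) => z.
  apply: ker_lift.
  by rewrite linearB linearZ /= ps subrr.
have qlin : forall c u v, q (c%:A *: u + v) = c%:A *: q u + q v.
  move=> c u v; apply: val_inj; rewrite linearP /= !qE linearP s1 (scalerDr idem) scaler_alg.
  by rewrite opprD (scalerBr c%:A) addrACA.
have qtransl e' z : e' \in D -> q (transl e' *: z) = transl e' *: q z.
  move=> De'; apply: val_inj; rewrite linearZ /= !qE linearZ /= sD // scalerBr.
  by rewrite !scalerA idem_transl transl_idem.
have qe z : q (transl e *: z) = transl e *: q z + delta (p z).
  apply: val_inj; rewrite linearD linearZ /= !qE deltaE linearZ /= scalerBr /delta0.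
  by rewrite !scalerA idem_transl transl_idem addrA subrK.
have betalin : transl_linear D (phi \o q).
  case: (philin) => f1 f2 f3; split; first split=> [c u v|z|z] /=.
  - by rewrite qlin f1.
  - rewrite -[LHS]f2 -[RHS]f2; congr phi; apply: val_inj.
    rewrite !linearZ /= !qE linearZ /= s2.
    by rewrite !scalerBr !scalerA !idem_mul_xi.
  - by rewrite f3.
  - by move=> e' De' z /=; rewrite qtransl // phiD'.2.
(* Both terms have the same defect, [phi] of [delta], so their difference commutes with [transl e]
   and lifts by projectivity of [F]. *)
have [|gamma [[glin gD] ggamma]] :=
    projF _ _ g (fun z => g (alpha z) - phi (q z)) gsurj.
  have [dlin dD] := transl_linear_sub (transl_linear_comp g alphalin) betalin.
  split=> // e'; rewrite inE => /predU1P[->|/dD //] z.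
  rewrite alphae qe /= linearD linearZ /= corner_linearD // phiD ?mem_head //.
  by rewrite gchi /= scalerBr opprD addrACA subrr addr0.
(* On the kernel the defect [chi] of [alpha] vanishes and [q] is multiplication by [idem], so [g]
   sends this difference to [phi]. *)
exists (fun k => alpha (val k) - gamma (val k)); split.
  have gammalin : transl_linear D gamma.
    by split=> // e' De'; apply: gD; rewrite inE De' orbT.
  have [vlin vD] := transl_linear_precomp (val : {linear ker p -> F})
    (transl_linear_sub alphalin gammalin).
  split=> // e'; rewrite inE => /predU1P[->|/vD //] k.
  rewrite linearZ /= alphae /= ker_valP (corner_linear0 chilin.1) addr0.
  by rewrite gD ?mem_head // -scalerBr.
move=> k; rewrite linearB ggamma opprB addrC subrK.
case: (philin) => f1 f2 f3; rewrite -[RHS]f2; congr phi; apply: val_inj.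
by rewrite qE ker_valP corner_linear0 // subr0 linearZ.
Qed.

(** * Averaging translation-linear maps to S-linear ones *)

Section AveragedMap.
Variables (M N : lmodType S) (h : M -> N).
Hypothesis hlin : corner_linear h.
Hypothesis htransl : forall e, commutes h (transl e).

Definition averaged (x : M) : N := \sum_(i <- reps) xi i base *: h (xi base i *: x).

Lemma averaged_shift i j e x :
  xi (i - e *+ 2) base *: h (xi base j *: x) = xi i base *: h (xi base (j + e *+ 2) *: x).
Proof. by rewrite -xi_mul_transl -transl_mul_xi -!scalerA htransl. Qed.

(** Centrality of the Casimir tensor: expanding [s] along rows on one side and along columns on the
    other gives the same sum, because [averaged_shift] moves a translation across [h]. *)
Lemma averagedZ s x : averaged (s *: x) = s *: averaged x.
Proof.
(* [half] recovers e from 2e, so [E] is a finite list holding every translation that occurs in the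
   coefficients of [s] between representatives. *)
pose half (q : idx) : idx := ((q.1 %/ 2)%Z, (q.2 %/ 2)%Z).
pose E := undup (flatten
  [seq [seq half (q - j) | q <- row_supp s i, j <- reps] | i <- reps]).
have sE i j e : i \in reps -> j \in reps -> s@_(orb i (j + e *+ 2)) != 0 -> e \in E.
  move=> ir jr /row_suppP sij; rewrite mem_undup; apply/flatten_mapP; exists i => //.
  apply/allpairsP; exists (j + e *+ 2, j); split=> //=.
  rewrite addrAC subrr add0r /half; case: (e) => a b; congr pair => /=; lia.
(* [sgn] is the identity for the row expansion and negation for the column expansion. *)
have uE (sgn : idx -> idx) : injective sgn ->
    uniq [seq j + sgn e *+ 2 | j <- reps, e <- E].
  move=> sgn_inj; apply: allpairs_uniq => //; first exact: undup_uniq.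
  move=> [i e] [j e'] /allpairsP[[i1 e1] [ir _ [-> _]]].
  move=> /allpairsP[[j1 e2] [jr _ [-> _]]] /reps_inj => /(_ ir jr) [-> /sgn_inj ->].
  by [].
transitivity (\sum_(i <- reps) \sum_(j <- reps) \sum_(e <- E)
    (s@_(orb i (j + e *+ 2)))%:A *: (xi i base *: h (xi base (j + e *+ 2) *: x))).
  rewrite /averaged big_seq [RHS]big_seq; apply: eq_bigr => i ir.
  rewrite scalerA (@row_expand s i [seq j + id e *+ 2 | j <- reps, e <- E]) ?uE //.
    rewrite corner_linear_expand // big_allpairs_dep scaler_sumr; apply: eq_bigr => j _.
    by rewrite scaler_sumr; apply: eq_bigr => e _; rewrite scaler_alg.
  move=> q; have [j [e [jr ->]]] := repsP q => /(sE i j e ir jr) eE.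
  by apply/allpairsP; exists (j, e).
rewrite exchange_big /averaged scaler_sumr big_seq [RHS]big_seq; apply: eq_bigr => j jr.
rewrite scalerA (@col_expand s j [seq i + (- e) *+ 2 | i <- reps, e <- E]).
- rewrite big_allpairs_dep scaler_suml; apply: eq_bigr => i _.
  rewrite scaler_suml; apply: eq_bigr => e _.
  by rewrite (scale_alg (xi _ base)) mulNrn averaged_shift -(orb_shift e (_ - _)) subrK.
- by apply: uE; exact: oppr_inj.
move=> p; have [i [e [ir ->]]] := repsP p => sp; apply/allpairsP; exists (i, - e).
split=> //=; last by rewrite opprK.
by apply: (sE i j) => //; rewrite -(orb_shift e) mulNrn subrK.
Qed.

End AveragedMap.

Definition dir1 : idx := (1, 0).
Definition dir2 : idx := (0, 1).

Lemma idx_dir (e : idx) : e = dir1 *~ e.1 + dir2 *~ e.2.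
Proof.
rewrite [RHS]surjective_pairing !raddfD /= !(raddfMz fst) !(raddfMz snd) /=.
by case: e => a b /=; congr pair; lia.
Qed.

Lemma transl_projective_projective (P : lmodType S) :
  transl_projective [:: dir2; dir1] P -> projective P.
Proof.
move=> projP M N g f gsurj.
have [psi [[psilin psiD] gpsi]] := projP _ _ g _ gsurj (transl_linear_idem _ f).
have comm e : commutes psi (transl e).
  rewrite (idx_dir e); apply: commutesD; apply: commutesMz => //; apply: psiD;
  by rewrite !inE eqxx ?orbT.
pose h x : M := ((2^-1 : rat)%:A : S) *: averaged psi x.
have hlin : linear h.
  move=> s u v; rewrite /h (scaler_alg s) -scalerDr; congr (_ *: _).
  rewrite -(averagedZ psilin comm) -big_split; apply: eq_bigr => i _ /=.
  by rewrite (scalerDr (xi _ _)) (corner_linearD _ _ psilin) (scalerDr (xi _ _)).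
pose hL := GRing.isLinear.Build S P M _ h hlin.
pose hH : {linear P -> M} := HB.pack h hL.
have half2 : (2^-1 : rat)%:A * 2%:R = 1 :> S.
  by rewrite mulr_algl -(scaler_nat 2 (1 : S)) scalerA mulVf // scale1r.
exists hH => x; rewrite /= /h linearZ /averaged linear_sum /=.
under eq_bigr do rewrite linearZ /= gpsi linearZ /= !scalerA mul_xi_idem.
by rewrite -scaler_suml casimir scalerA half2 scale1r.
Qed.

(** * Maps out of free modules, given by values on a rational basis of the corner *)

Lemma eq_sum_supp (I : eqType) (V : zmodType) (F : I -> V) (r r' : seq I) :
    uniq r -> uniq r' -> (forall i, F i != 0 -> i \in r) ->
    (forall i, F i != 0 -> i \in r') ->
  \sum_(i <- r) F i = \sum_(i <- r') F i.
Proof.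
move=> ur ur' hr hr'.
have supp s : \sum_(i <- s) F i = \sum_(i <- [seq i <- s | F i != 0]) F i.
  rewrite big_filter [RHS]big_mkcond; apply: eq_bigr => i _.
  by case: eqP.
rewrite supp [RHS]supp; apply/perm_big/uniq_perm; rewrite ?filter_uniq // => i.
by rewrite !mem_filter; case: (boolP (F i != 0)) => // h; rewrite hr ?hr'.
Qed.

Section RowExtend.
Variables (V : lmodType S) (v : idx -> V).

Definition row_extend (s : S) : V :=
  \sum_(q <- row_supp s base) (s@_(orb base q))%:A *: v q.

Lemma row_extendE (s : S) D : uniq D -> (forall q, s@_(orb base q) != 0 -> q \in D) ->
  row_extend s = \sum_(q <- D) (s@_(orb base q))%:A *: v q.
Proof.
have nz q : (s@_(orb base q))%:A *: v q != 0 -> s@_(orb base q) != 0.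
  by apply: contraNneq => ->; rewrite !scale0r.
move=> uD sD; apply: eq_sum_supp; rewrite ?undup_uniq // => q /nz; last exact: sD.
exact: row_suppP.
Qed.

Lemma row_extendP c s s' :
  row_extend (c *: s + s') = c%:A *: row_extend s + row_extend s'.
Proof.
pose D := undup (row_supp (c *: s + s') base ++ row_supp s base ++ row_supp s' base).
rewrite !(@row_extendE _ D) ?undup_uniq //.
- rewrite scaler_sumr -big_split; apply: eq_bigr => q _ /=.
  by rewrite mcoeffD mcoeffZ [(_ + _)%:A]scalerDl -[(_ * _)%:A]scalerA scalerDl scale_alg.
- by move=> q /row_suppP h; rewrite mem_undup !mem_cat h !orbT.
- by move=> q /row_suppP h; rewrite mem_undup !mem_cat h !orbT.
- by move=> q /row_suppP h; rewrite mem_undup !mem_cat h.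
Qed.

Lemma row_extend_idem s : row_extend (idem * s) = row_extend s.
Proof.
pose D := undup (row_supp (idem * s) base ++ row_supp s base).
rewrite !(@row_extendE _ D) ?undup_uniq //.
- by apply: eq_bigr => q _; rewrite mcoeff_base_mul.
- by move=> q /row_suppP h; rewrite mem_undup !mem_cat h !orbT.
- by move=> q /row_suppP h; rewrite mem_undup !mem_cat h.
Qed.

Lemma row_extend_xi q : row_extend (xi base q) = v q.
Proof.
rewrite (@row_extendE _ [:: q]) // => [|q'].
  by rewrite big_seq1 mcoeff_xi eqxx !scale1r.
by rewrite mcoeff_xi orb_basel inE [q' == q]eq_sym; case: (q == q'); rewrite // mulr0n eqxx.
Qed.

End RowExtend.

Section FreeModule.
Variables (K : choiceType) (V : lmodType S).
Local Notation F := {malg S[K]}.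
Implicit Types (u : K -> idx -> V) (h : F -> V).

Definition free_extend u (z : F) : V :=
  \sum_(k <- msupp z) row_extend (u k) z@_k.

Lemma row_extend0 (v : idx -> V) : row_extend v 0 = 0.
Proof. by rewrite (@row_extendE _ _ _ [::]) ?big_nil // => q; rewrite mcoeff0 eqxx. Qed.

Lemma free_extendE u z (D : seq K) : uniq D -> {subset msupp z <= D} ->
  free_extend u z = \sum_(k <- D) row_extend (u k) z@_k.
Proof.
have nz k : row_extend (u k) z@_k != 0 -> k \in msupp z.
  by rewrite -mcoeff_neq0; apply: contraNneq => ->; rewrite row_extend0.
by move=> uD zD; apply: eq_sum_supp; rewrite ?fset_uniq // => k /nz //; apply: zD.
Qed.

Lemma free_extend_linear u : (forall k q, idem *: u k q = u k q) ->
  corner_linear (free_extend u).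
Proof.
move=> hu; split=> [c y z|z|z].
- pose D := undup (msupp (c%:A *: y + z) ++ msupp y ++ msupp z).
  rewrite !(@free_extendE _ _ D) ?undup_uniq //.
  + rewrite scaler_sumr -big_split; apply: eq_bigr => k _ /=.
    by rewrite mcoeffD mcoeffZ mulr_algl row_extendP.
  + by move=> k h; rewrite mem_undup !mem_cat h !orbT.
  + by move=> k h; rewrite mem_undup !mem_cat h !orbT.
  + by move=> k h; rewrite mem_undup !mem_cat h.
- rewrite (@free_extendE _ _ (undup (msupp (idem *: z) ++ msupp z))) ?undup_uniq //.
    rewrite [RHS](@free_extendE _ _ (undup (msupp (idem *: z) ++ msupp z))) ?undup_uniq //.
      by apply: eq_bigr => k _; rewrite mcoeffZ row_extend_idem.
    by move=> k h; rewrite mem_undup !mem_cat h !orbT.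
  by move=> k h; rewrite mem_undup !mem_cat h.
rewrite scaler_sumr; apply: eq_bigr => k _.
by rewrite scaler_sumr; apply: eq_bigr => q _; rewrite scaler_alg hu.
Qed.

Lemma free_extend_basis u k q : free_extend u << xi base q *g k >> = u k q.
Proof.
rewrite (@free_extendE _ _ [:: k]) // => [|k' /(fsubsetP msuppU_le)].
  by rewrite big_seq1 mcoeffUU row_extend_xi.
by rewrite !inE.
Qed.

Lemma free_extend_unique h z : corner_linear h ->
  h z = free_extend (fun k q => h << xi base q *g k >>) z.
Proof.
move=> hl; case: (hl) => _ h2 _.
rewrite {1}(monalgE z) corner_linear_sum //; apply: eq_bigr => k _.
have -> s : << s *g k >> = s *: << 1 *g k >> :> F.
  by apply/malgP => k'; rewrite mcoeffZ !mcoeffU mulrnAr mulr1.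
rewrite -h2 scalerA (@row_expand _ _ (row_supp z@_k base)) ?undup_uniq //; last first.
  exact: row_suppP.
rewrite corner_linear_expand //; apply: eq_bigr => q _; congr (_ *: h _).
by apply/malgP => k'; rewrite mcoeffZ !mcoeffU mulrnAr mulr1.
Qed.

Lemma free_ext h h' : corner_linear h -> corner_linear h' ->
  (forall k q, h << xi base q *g k >> = h' << xi base q *g k >>) -> h =1 h'.
Proof.
move=> hl hl' hh z; rewrite free_extend_unique // [RHS]free_extend_unique //.
by apply: eq_bigr => k _; apply: eq_bigr => q _; rewrite hh.
Qed.

Lemma transl_basis e k q :
  transl e *: << xi base q *g k >> = << xi base (q + e *+ 2) *g k >> :> F.
Proof. by apply/malgP => k'; rewrite mcoeffZ !mcoeffU mulrnAr transl_mul_xi. Qed.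

Lemma free_extend_transl u e : (forall k q, idem *: u k q = u k q) ->
    (forall k q, u k (q + e *+ 2) = transl e *: u k q) ->
  commutes (free_extend u) (transl e).
Proof.
move=> hu ue z; have ul := free_extend_linear hu.
apply: (free_ext (corner_linear_pre e ul) (corner_linear_post e ul)) => k q.
by rewrite transl_basis !free_extend_basis.
Qed.

End FreeModule.

(* n q, of which 2 n q is the component of q along D, is the translation that
   carries a representative q - 2 n q of the coset of q to q. *)
Lemma free_transl_projective (K : choiceType) (D : seq idx) (n : idx -> idx) :
    (forall e q, e \in D -> n (q + e *+ 2) = n q + e) ->
    (forall (M N : lmodType S) (h : M -> N) q,
      transl_linear D h -> commutes h (transl (n q))) ->
  transl_projective D {malg S[K]}.
Proof.
move=> nD nspan X Y g phi gsurj philin; have [phil phiD] := philin.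
have [sigma gsigma] := choice gsurj.
(* Lifts are chosen freely at coset representatives and transported along the coset; the factor
   [transl] also puts them in the corner. *)
pose u k q := transl (n q) *: sigma (phi << xi base (q - n q *+ 2) *g k >>).
have hu k q : idem *: u k q = u k q by rewrite scalerA idem_transl.
have ul := free_extend_linear hu.
exists (free_extend u); split; first split=> // e De.
  apply: free_extend_transl => // k q.
  by rewrite /u nD // mulrnDl opprD [- _ - _]addrC addrA addrK scalerA translM [e + _]addrC.
apply: (free_ext (corner_linear_comp g ul) phil) => k q /=.
by rewrite free_extend_basis linearZ /= gsigma -nspan // transl_basis subrK.
Qed.

(** On a line of indices in direction 2e, with position [n], the equation for alpha is a first-order
    recursion, solved by variation of constants with value 0 at position 0. Invariance of [n] under
    D keeps the solution D-linear. *)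
Lemma free_transl_acyclic (K : choiceType) (D : seq idx) (e : idx) (n : idx -> int) :
    (forall q, n (q + e *+ 2) = n q + 1) ->
    (forall e' q, e' \in D -> n (q + e' *+ 2) = n q) ->
  transl_acyclic D e {malg S[K]}.
Proof.
move=> ne nD X chi [chil chiD].
(* The summand at position j of the line through q, pulled back by j + 1 translations; it depends
   only on the line, not on q. *)
pose w k q (j : int) :=
  transl (- (e *~ (j + 1))) *: chi << xi base (q + (e *~ (j - n q)) *+ 2) *g k >>.
pose u k q := transl (e *~ n q) *: antidiff (w k q) (n q).
have hu k q : idem *: u k q = u k q by rewrite scalerA idem_transl.
have ul := free_extend_linear hu.
have [c1 c2 c3] := chil.
exists (free_extend u); split; first split=> // e' De'.
  apply: free_extend_transl => // k q; rewrite /u nD // !antidiff_scale.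
  apply: eq_antidiff => j; rewrite /w nD // addrAC -transl_basis chiD //.
  by rewrite !scalerA !translM; congr (transl _ *: _); rewrite -[RHS]addrA [RHS]addrC.
have lin2 := corner_linear_add (corner_linear_post e ul) chil.
apply: (free_ext (corner_linear_pre e ul) lin2) => k q.
rewrite transl_basis !free_extend_basis /u ne.
have -> : antidiff (w k (q + e *+ 2)) (n q + 1) = antidiff (w k q) (n q + 1).
  apply: eq_antidiff => j; rewrite /w ne; congr (_ *: chi << xi base _ *g k >>).
  rewrite -addrA -mulrnDl -[X in X + e *~ _]mulr1z -mulrzDr; congr (_ + _ *~ _ *+ 2); lia.
rewrite antidiffS scalerDr scalerA translM mulrzDr mulr1z [e + _]addrC; congr (_ + _).
rewrite /w subrr mul0rn addr0 scalerA translM mulrzDr mulr1z subrr transl0.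
by rewrite c3.
Qed.

Lemma free_transl_projective1 (K : choiceType) :
  transl_projective [:: dir1] {malg S[K]}.
Proof.
apply: (@free_transl_projective _ _
  (fun q => dir1 *~ (q.1 %/ 2)%Z)) => [e [a b]|M N h q [hl hD]].
  rewrite inE => /eqP->; rewrite -[X in _ = _ + X]mulr1z -mulrzDr.
  by congr (_ *~ _) => /=; lia.
by apply: commutesMz => //; apply: hD; rewrite inE.
Qed.

Lemma free_transl_projective2 (K : choiceType) :
  transl_projective [:: dir2; dir1] {malg S[K]}.
Proof.
apply: (@free_transl_projective _ _
  (fun q => dir1 *~ (q.1 %/ 2)%Z + dir2 *~ (q.2 %/ 2)%Z)) => [e [a b]|M N h q [hl hD]].
  rewrite !inE => /orP[] /eqP->.
    rewrite -addrA -[X in _ = _ + (_ + X)]mulr1z -mulrzDr.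
    by congr (_ *~ _ + _ *~ _) => /=; lia.
  rewrite addrAC -[X in _ = _ + X + _]mulr1z -mulrzDr.
  by congr (_ *~ _ + _ *~ _) => /=; lia.
by apply: commutesD; apply: commutesMz => //; apply: hD; rewrite !inE eqxx ?orbT.
Qed.

Lemma free_transl_acyclic1 (K : choiceType) : transl_acyclic [::] dir1 {malg S[K]}.
Proof.
by apply: (@free_transl_acyclic _ _ _ (fun q => (q.1 %/ 2)%Z)) => // -[a b] /=; lia.
Qed.

Lemma free_transl_acyclic2 (K : choiceType) : transl_acyclic [:: dir1] dir2 {malg S[K]}.
Proof.
apply: (@free_transl_acyclic _ _ _ (fun q => (q.2 %/ 2)%Z)) => [[a b]|e [a b]] /=.
  lia.
by rewrite inE => /eqP-> /=; lia.
Qed.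

(** * The base case over the rationals *)

(** An alias that carries the rational scalars, apart from the S-module structure on M. *)
Definition rat_restriction (M : lmodType S) : Type := M.
HB.instance Definition _ (M : lmodType S) := GRing.Zmodule.on (rat_restriction M).

Section RatRestriction.
Variable M : lmodType S.
Let scale (c : rat) (x : rat_restriction M) : rat_restriction M := (c%:A : S) *: (x : M).

Fact rat_scaleA a b x : scale a (scale b x) = scale (a * b) x.
Proof. by rewrite /scale [LHS]scalerA mulr_algl scalerA. Qed.

Fact rat_scale1 : left_id 1 scale.
Proof. by move=> x; rewrite /scale !scale1r. Qed.

Fact rat_scaleDr : right_distributive scale +%R.
Proof. by move=> c x y; rewrite /scale [LHS](scalerDr c%:A). Qed.

Fact rat_scaleDl x : {morph scale^~ x : a b / a + b}.
Proof. by move=> a b; rewrite /scale scalerDl [LHS]scalerDl. Qed.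

HB.instance Definition _ := GRing.Zmodule_isLmodule.Build rat (rat_restriction M)
  rat_scaleA rat_scale1 rat_scaleDr rat_scaleDl.

End RatRestriction.

(** With no translation to respect, a rational linear section of [g], cut down by [idem], lifts
    everything. *)
Lemma transl_projective0 (P : lmodType S) : transl_projective [::] P.
Proof.
move=> X Y g phi gsurj [[f1 f2 f3] _].
have glin : linear (g : rat_restriction X -> rat_restriction Y).
  by move=> c x y; exact: (linearP g).
pose gL := GRing.isLinear.Build rat (rat_restriction X) (rat_restriction Y) _ _ glin.
pose gH : {linear rat_restriction X -> rat_restriction Y} :=
  HB.pack (g : rat_restriction X -> rat_restriction Y) gL.
have [s sK] : exists s : {linear rat_restriction Y -> rat_restriction X}, cancel s gH.
  exact: linear_section.
have slin c u v : s (c%:A *: u + v : Y) = c%:A *: (s u : X) + s v := linearP s c u v.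
exists (fun z => idem *: (s (phi z) : X)); split; first split=> //.
  split=> [c u v|z|z]; first by rewrite f1 slin (scalerDr idem) scaler_alg.
  - by rewrite f2.
  - by rewrite scalerA idem_mul_xi.
by move=> z; rewrite linearZ /= (sK (phi z)) f3.
Qed.

(** * Canonical free covers and the bound *)

Definition free_cover (M : lmodType S) (z : {malg S[M]}) : M :=
  \sum_(m <- msupp z) z@_m *: m.

Lemma free_coverE (M : lmodType S) (z : {malg S[M]}) (D : seq M) : uniq D ->
  {subset msupp z <= D} -> free_cover z = \sum_(m <- D) z@_m *: m.
Proof.
have nz m : z@_m *: m != 0 -> m \in msupp z.
  by rewrite -mcoeff_neq0; apply: contraNneq => ->; rewrite scale0r.
by move=> uD zD; apply: eq_sum_supp; rewrite ?fset_uniq // => m /nz //; apply: zD.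
Qed.

Fact free_cover_linear (M : lmodType S) : linear (@free_cover M).
Proof.
move=> s y z; pose D := undup (msupp (s *: y + z) ++ msupp y ++ msupp z).
rewrite !(@free_coverE _ _ D) ?undup_uniq //.
- rewrite scaler_sumr -big_split; apply: eq_bigr => m _ /=.
  by rewrite mcoeffD mcoeffZ scalerDl scalerA.
- by move=> k h; rewrite mem_undup !mem_cat h !orbT.
- by move=> k h; rewrite mem_undup !mem_cat h !orbT.
- by move=> k h; rewrite mem_undup !mem_cat h.
Qed.

HB.instance Definition _ (M : lmodType S) :=
  GRing.isLinear.Build S {malg S[M]} M _ (@free_cover M) (@free_cover_linear M).

Lemma free_cover_surj (M : lmodType S) (m : M) : exists z, @free_cover M z = m.
Proof.
exists << 1 *g m >>; rewrite (@free_coverE _ _ [:: m]) // => [|k /(fsubsetP msuppU_le)].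
  by rewrite big_seq1 mcoeffUU scale1r.
by rewrite !inE.
Qed.

Theorem corollary4p7 : finite_global_dimension affine_schur22.
Proof.
(* One syzygy is spent on each of the directions [dir1] and [dir2]. *)
exists 2 => M; pose K1 := ker (@free_cover M); pose K2 := ker (@free_cover K1).
have K1proj : transl_projective [:: dir1] K1.
  apply: ker_transl_projective; first exact: free_cover_surj.
  - exact: transl_projective0.
  - exact: free_transl_projective1.
  - exact: free_transl_acyclic1.
have K2proj : transl_projective [:: dir2; dir1] K2.
  apply: ker_transl_projective; first exact: free_cover_surj.
  - exact: K1proj.
  - exact: free_transl_projective2.
  - exact: free_transl_acyclic2.
have freeproj (K : choiceType) : projective ({malg S[K]} : lmodType S).
  exact/transl_projective_projective/free_transl_projective2.
apply: (ker_proj_dim_le (freeproj M) (@free_cover_surj M)).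
apply: (ker_proj_dim_le (freeproj K1) (@free_cover_surj K1)).
exact/projective_proj_dim_le/transl_projective_projective.
Qed.
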